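(* There is $A_0>1$ such that for every $A\ge A_0$ the following holds. Let $\xi=\{\xi_j\}_{j=0}^\infty$ be a Rademacher sequence, let $n_0=1$ and define $n_{k+1}=\min\{l\in\mathbf N: g(l)\ge A\,g(n_k)\}$ for $k\ge0$. Let $\{\nu_k\}$ be any sequence of positive numbers increasing to $\infty$. Define $a_0=a_1=a_2=0$ and, for $j\ge 3$, $$a_j=\nu_k\frac{g(n_k)}{\sqrt{n_k\log n_k}},\qquad n_{k-1}<j\le n_k .$$ Then for all $k\ge 1$ $$\Big(\sum_{j=n_{k-1}+1}^{n_k}a_j^2\Big)^{1/2}\le \nu_k\frac{g(n_k)}{\sqrt{\log n_k}},$$ but almost surely $u(z,\xi)=\sum_{j=0}^\infty a_j\xi_j r^j\cos j\theta$ ($z=re^{i\theta}$) does not belong to $h^\infty_v(\mathbf D)$.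
   Context: $\mathbf D$ is the open unit disk. The weight $v$ is a positive increasing continuous function on $[0,1)$ with $v(0)=1$, $\lim_{r\to 1}v(r)=+\infty$, satisfying $v(1-t)\le D\,v(1-2t)$ for $0<t\le 1/2$ and some constant $D$. Put $g(x)=v(1-1/x)$ for $x\ge 1$, so $g(2x)\le D g(x)$. $h^\infty_v(\mathbf D)$ is the set of harmonic functions $u:\mathbf D\to\mathbf R$ with $|u(z)|\le K v(|z|)$ on $\mathbf D$ for some $K>0$. A Rademacher sequence is a sequence of independent random variables taking the values $1$ and $-1$ with probability $1/2$ each. *)

(* Defs.v *)
From HB Require Import structures.
From mathcomp Require Export all_boot all_order all_algebra.
From mathcomp Require Export all_classical all_reals all_analysis.
Set Implicit Arguments.
Unset Strict Implicit.
Unset Printing Implicit Defensive.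
Import Order.TTheory GRing.Theory Num.Theory.
Import numFieldNormedType.Exports.
Local Open Scope classical_set_scope.
Local Open Scope ring_scope.

                                                                         
                                             
Record doubling_weight (R : realType) (v : R -> R) : Prop := DoublingWeight {
  weight_gt0 : forall r, 0 <= r < 1 -> 0 < v r;
  weight_nondecreasing : forall r s, 0 <= r -> r <= s -> s < 1 -> v r <= v s;
  weight_continuous : {within `[0, 1[, continuous v};
  weight0 : v 0 = 1;
  weight_pinfty : v r @[r --> 1^'-] --> +oo;
  weight_doubling : exists D : R,
    forall t, 0 < t <= 2^-1 -> v (1 - t) <= D * v (1 - 2 * t) }.

                                   
Definition weight_g (R : realType) (v : R -> R) (x : R) : R := v (1 - x^-1).

                                                                             
                                                                      
Definition modulus (R : realType) (z : R * R) : R :=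
  Num.sqrt (z.1 ^+ 2 + z.2 ^+ 2).

Definition unit_disk (R : realType) : set (R * R) := [set z | modulus z < 1].

Definition polar (R : realType) (r theta : R) : R * R :=
  (r * cos theta, r * sin theta).

Definition partial_x (R : realType) (f : R * R -> R) (z : R * R) : R :=
  'D_(1, 0) f z.

Definition partial_y (R : realType) (f : R * R -> R) (z : R * R) : R :=
  'D_(0, 1) f z.

Definition C1_on (R : realType) (U : set (R * R)) (f : R * R -> R) : Prop :=
  forall z, U z ->
    [/\ derivable f z (1, 0), derivable f z (0, 1),
        {for z, continuous (partial_x f)} & {for z, continuous (partial_y f)}].

Definition C2_on (R : realType) (U : set (R * R)) (f : R * R -> R) : Prop :=
  [/\ C1_on U f, C1_on U (partial_x f) & C1_on U (partial_y f)].

                                                                               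
Definition harmonic_on (R : realType) (U : set (R * R)) (f : R * R -> R) :
    Prop :=
  C2_on U f /\
  forall z, U z ->
    partial_x (partial_x f) z + partial_y (partial_y f) z = 0.

                                                                               
Definition hv_infty (R : realType) (v : R -> R) : set (R * R -> R) :=
  [set u | harmonic_on (@unit_disk R) u /\
    exists2 K : R, 0 < K &
      forall z, unit_disk z -> `|u z| <= K * v (modulus z)].

                                                                        
                                                            
Definition cos_series_in_hv (R : realType) (v : R -> R) (b : nat -> R) : Prop :=
  exists2 u : R * R -> R, hv_infty v u &
    forall r theta : R, 0 <= r < 1 ->
      series (fun j : nat => b j * r ^+ j * cos (j%:R * theta)) @ \oo
        --> u (polar r theta).

Definition mutually_independent (d : measure_display) (T : measurableType d)
    (R : realType) (P : probability T R) (X : nat -> {RV P >-> R}) : Prop :=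
  forall (s : seq nat) (B : nat -> set R),
    uniq s -> (forall i, measurable (B i)) ->
    P (\bigcap_(i in [set` s]) (X i @^-1` B i)) =
    (\prod_(i <- s) P (X i @^-1` B i))%E.

Definition rademacher_sequence (d : measure_display) (T : measurableType d)
    (R : realType) (P : probability T R) (xi : nat -> {RV P >-> R}) : Prop :=
  mutually_independent xi /\
  forall j, P (xi j @^-1` [set 1]) = (2^-1)%:E /\
            P (xi j @^-1` [set -1]) = (2^-1)%:E.

Definition is_min (S : set nat) (l : nat) : Prop :=
  S l /\ forall m, S m -> (l <= m)%N.

(* Main.v *)
Require Import Defs.
From mathcomp Require Import ring lra.
Set Implicit Arguments.
Unset Strict Implicit.
Unset Printing Implicit Defensive.
Import Order.TTheory GRing.Theory Num.Theory.
Import numFieldNormedType.Exports.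
Local Open Scope classical_set_scope.
Local Open Scope ring_scope.

(** Take [A] larger than the doubling constant, so that [2 n_{k-1} < n_k].  If
[u] is in [h^oo_v] with constant [K], then for every [k] the values of [u] at
radius [r = 1 - 1/n_k] are at most [K g(n_k)]; it suffices that, for fixed [K],
the probability of this event is arbitrarily small for some [k].  Test it at the
[2^m] points [i/2^m], where [2^m] is about [n_k^(1/4)].  The k-th block alone
gives [u] a standard deviation of order [nu_k g(n_k) / sqrt(log n_k)] at each of
these points, with almost no correlation between distinct points, and since
[nu_k] tends to infinity the threshold is only [o(sqrt(log n_k))] standard
deviations.  For [t_ij = tau r^j cos(j theta_i)] with [tau^2 = log n_k / (8 n_k)]
the Riesz products [W_i = prod_j (1 + t_ij xi_j)] satisfy [E W_i = 1] and
[E (W_i W_i') = prod_j (1 + t_ij t_i'j)], so their average over [i] concentrates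
at 1; but [W_i <= exp (sum_j t_ij xi_j - sum_j t_ij^2 / 8)] forces this average
to be at most 1/2 when all the block sums are below the threshold. *)

(** * Second moments of Riesz products *)

Section SecondMoment.
Variable R : realType.

(** The tangent bound [1 + y <= expR y] at [y = x - x ^+ 2 / 8] is too weak. Applied at [z = y / 2]
    and squared, it gains [z ^+ 2], which outweighs the loss [x ^+ 2 / 8] when [|x| <= 1]. *)
Lemma onePx_le_expR (x : R) : `|x| <= 1 -> 1 + x <= expR (x - x ^+ 2 / 8).
Proof.
rewrite ler_norml => /andP[x1 x2].
pose z := (x - x ^+ 2 / 8) / 2.
have z1 : 0 <= 1 + z by rewrite /z; nra.
have -> : x - x ^+ 2 / 8 = z + z by rewrite /z; field.
rewrite expRD -expr2.
apply: (@le_trans _ _ ((1 + z) ^+ 2)); last first.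
  by rewrite ler_pXn2r ?nnegrE ?expR_ge0 ?expR_ge1Dx.
rewrite /z; have : 0 <= x ^+ 2 by apply: sqr_ge0.
move=> x0; have h : 0 <= x ^+ 2 * (2 - x) by rewrite mulr_ge0//; lra.
have h4 : 0 <= x ^+ 2 * x ^+ 2 by rewrite mulr_ge0.
nra.
Qed.

Variable J : finType.
Implicit Types (t s : J -> R) (h f : {ffun J -> bool}).

(** A sign vector is a boolean vector, [true] standing for the sign -1, so an expectation over
    independent signs is a sum over [h] divided by [2 ^+ #|J|]. *)
Definition riesz t h : R := \prod_j (1 + t j * (-1) ^+ h j).

Lemma sum_signs_prod (F : J -> bool -> R) :
  \sum_(h : {ffun J -> bool}) \prod_j F j (h j) =
  \prod_j (F j true + F j false).
Proof. by rewrite -bigA_distr_bigA; apply: eq_bigr => j _; rewrite big_bool. Qed.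

Lemma sum_riesz t : \sum_h riesz t h = 2 ^+ #|J|.
Proof.
rewrite (sum_signs_prod (fun j b => 1 + t j * (-1) ^+ b)).
rewrite -(@prodr_const _ J); apply: eq_bigr => j _ /=; rewrite expr1 expr0; ring.
Qed.

Lemma sum_riesz2 t s :
  \sum_h riesz t h * riesz s h = 2 ^+ #|J| * \prod_j (1 + t j * s j).
Proof.
transitivity (\sum_(h : {ffun J -> bool})
    \prod_j ((1 + t j * (-1) ^+ h j) * (1 + s j * (-1) ^+ h j))).
  by apply: eq_bigr => h _; rewrite big_split.
rewrite (sum_signs_prod (fun j b => (1 + t j * (-1) ^+ b) * (1 + s j * (-1) ^+ b))).
rewrite -(@prodr_const _ J) -big_split/=; apply: eq_bigr => j _ /=.
rewrite expr1 expr0; ring.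
Qed.

Lemma prod1D_le_expR t s : (forall j, `|t j| <= 1) -> (forall j, `|s j| <= 1) ->
  \prod_j (1 + t j * s j) <= expR (\sum_j t j * s j).
Proof.
move=> t1 s1; rewrite expR_sum; apply: ler_prod => j _; rewrite expR_ge1Dx andbT.
have : `|t j * s j| <= 1 by rewrite normrM mulr_ile1.
by rewrite ler_norml => /andP[? _]; lra.
Qed.

Lemma riesz_le_expR t h : (forall j, `|t j| <= 1) ->
  riesz t h <= expR (\sum_j t j * (-1) ^+ h j - (\sum_j t j ^+ 2) / 8).
Proof.
move=> t1; rewrite mulr_suml -sumrB expR_sum; apply: ler_prod => j _.
have t1' : `|t j * (-1) ^+ h j| <= 1.
  by rewrite normrM normrX normrN1 expr1n mulr1.
apply/andP; split; first by move: t1'; rewrite ler_norml => /andP[? _]; lra.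
by apply: le_trans (onePx_le_expR t1') _; rewrite exprMn sqrr_sign mulr1.
Qed.

(* Chebyshev's inequality for the average [w] over [i] of the Riesz products
   [riesz (t i)]: [w] has mean 1, and [w h <= 1/2] on the counted set. *)
Lemma count_small_signs (I : finType) (t : I -> J -> R) (T s V eta : R) :
  (0 < #|I|)%N -> (forall i j, `|t i j| <= 1) ->
  (forall i, s <= \sum_j t i j ^+ 2) -> (forall i, \sum_j t i j ^+ 2 <= V) ->
  (forall i i', i != i' -> \sum_j t i j * t i' j <= eta) ->
  expR (T - s / 8) <= 2^-1 ->
  #|[pred h : {ffun J -> bool} | [forall i, \sum_j t i j * (-1) ^+ h j <= T]]|%:R
    <= 4 * (expR V / #|I|%:R + expR eta - 1) * 2 ^+ #|J|.
Proof.
move=> I0 t1 ts tV teta Ts.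
pose M : R := #|I|%:R.
have M0 : 0 < M by rewrite ltr0n.
have MN0 : M != 0 by rewrite gt_eqF.
pose w h := M^-1 * \sum_i riesz (t i) h.
have w1 : \sum_h w h = 2 ^+ #|J|.
  rewrite -mulr_sumr exchange_big/= (eq_bigr (fun=> 2 ^+ #|J|)); last first.
    by move=> i _; rewrite sum_riesz.
  by rewrite sumr_const -[_ *+ #|_|]mulr_natl mulrA mulVf ?mul1r.
(* In the double sum over pairs of indices, each diagonal pair costs at most [expR V] and each other
   pair at most [expR eta]; the latter are counted as if there were [M] of them for every [i]. *)
have w2 : \sum_h w h ^+ 2 <= 2 ^+ #|J| * (expR V / M + expR eta).
  have -> : \sum_h w h ^+ 2 =
      M^-1 ^+ 2 * (2 ^+ #|J| * \sum_i \sum_i' \prod_j (1 + t i j * t i' j)).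
    have e i : 2 ^+ #|J| * (\sum_i' \prod_j (1 + t i j * t i' j)) =
        \sum_h riesz (t i) h * \sum_i' riesz (t i') h.
      rewrite mulr_sumr; under eq_bigr => i' _ do rewrite -sum_riesz2.
      by rewrite exchange_big/=; apply: eq_bigr => h _; rewrite mulr_sumr.
    rewrite mulr_sumr (eq_bigr _ (fun i _ => e i)) exchange_big/= mulr_sumr.
    by apply: eq_bigr => h _; rewrite /w exprMn expr2 -mulr_suml.
  rewrite mulrCA ler_pM2l ?exprn_gt0//.
  have le1 : \sum_i \sum_i' \prod_j (1 + t i j * t i' j)
     <= \sum_(i : I) (expR V + M * expR eta).
    apply: ler_sum => i _; rewrite (bigD1 i)//= lerD//.
      apply: le_trans (prod1D_le_expR (t1 i) (t1 i)) _.
      by rewrite ler_expR; apply: le_trans (tV i); apply: ler_sum => j _; rewrite expr2.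
    apply: (@le_trans _ _ (\sum_(i' | i' != i) expR eta)).
      apply: ler_sum => i' ii'; apply: le_trans (prod1D_le_expR (t1 i) (t1 i')) _.
      by rewrite ler_expR teta// eq_sym.
    apply: (@le_trans _ _ (\sum_(i' : I) expR eta)); last first.
      by rewrite sumr_const mulr_natl.
    by rewrite [leRHS](bigD1 i)//= lerDr expR_ge0.
  apply: (le_trans (ler_wpM2l _ le1)); first by rewrite exprn_ge0// invr_ge0 ltW.
  rewrite sumr_const -[_ *+ #|_|]mulr_natl -/M le_eqVlt; apply/orP; left; apply/eqP.
  by field.
pose G := [pred h : {ffun J -> bool} | [forall i, \sum_j t i j * (-1) ^+ h j <= T]].
have : \sum_(h in G) (4^-1 : R) <= \sum_h (w h - 1) ^+ 2.
  rewrite [leRHS](bigID (mem G))/= -[leLHS]addr0 lerD//; last first.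
    by apply: sumr_ge0 => h _; apply: sqr_ge0.
  apply: ler_sum => h; rewrite inE => /forallP hG.
  have w12 : w h <= 2^-1.
    rewrite /w mulrC ler_pdivrMr// mulrC.
    apply: (@le_trans _ _ (\sum_(i : I) 2^-1)); last first.
      by rewrite sumr_const -[_ *+ #|_|]mulr_natl.
    apply: ler_sum => i _; apply: le_trans (riesz_le_expR _ (t1 i)) (le_trans _ Ts).
    rewrite ler_expR lerB//. 
    by rewrite ler_pM2r ?invr_gt0.
  nra.
under eq_bigr do rewrite -[4^-1]mulr1.
have -> : \sum_h (w h - 1) ^+ 2 = \sum_h w h ^+ 2 - 2 ^+ #|J|.
  under eq_bigr do rewrite sqrrB1.
  rewrite big_split/= sumrB sumr_const card_ffun card_bool sumrMnl w1 natrX.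
  ring.
rewrite sumr_const mulr1 => le2.
have {}le2 := le_trans le2 (lerB w2 (lexx _)).
rewrite -[_ *+ _]mulr_natl in le2.
have -> : #|[pred h : {ffun J -> bool} | [forall i, \sum_j t i j * (-1) ^+ h j <= T]]|%:R
  = 4 * (#|G|%:R * 4^-1) :> R by field.
by rewrite -mulrA ler_pM2l//; apply: le_trans le2 _; rewrite -/M; lra.
Qed.

End SecondMoment.

(* Averaging over the sign flips inside [B] amounts to conditioning on the signs
   outside [B]; their contribution [y i] only matters through its sign, which is
   absorbed into the coefficients [x i]. *)
Lemma count_small_sums (R : realType) (I J : finType) (B : pred J)
    (x : I -> J -> R) (T s V eta : R) :
  (0 < #|I|)%N -> (forall i j, B j -> `|x i j| <= 1) ->
  (forall i, s <= \sum_(j | B j) x i j ^+ 2 <= V) ->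
  (forall i i', i != i' -> `|\sum_(j | B j) x i j * x i' j| <= eta) ->
  expR (T - s / 8) <= 2^-1 ->
  #|[pred f : {ffun J -> bool} | [forall i, `|\sum_j x i j * (-1) ^+ f j| <= T]]|%:R
    <= 4 * (expR V / #|I|%:R + expR eta - 1) * 2 ^+ #|J|.
Proof.
move=> I0 x1 sV xeta Ts; set F := [pred f | _].
pose flip (h f : {ffun J -> bool}) := [ffun j => f j (+) (B j && h j)].
have flipK h : involutive (flip h).
  by move=> f; apply/ffunP => j; rewrite !ffunE addbK.
have inner f : #|[pred h | F (flip h f)]|%:R
    <= 4 * (expR V / #|I|%:R + expR eta - 1) * 2 ^+ #|J|.
  pose y i := \sum_(j | ~~ B j) x i j * (-1) ^+ f j.
  pose t i j := if B j then (-1) ^+ (y i < 0)%R * (x i j * (-1) ^+ f j) else 0.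
  have t2 i i' : \sum_j t i j * t i' j =
      (-1) ^+ (y i < 0)%R * (-1) ^+ (y i' < 0)%R * \sum_(j | B j) x i j * x i' j.
    rewrite (bigID B)/= [X in _ + X]big1 ?addr0; last first.
      by move=> j /negbTE Bj; rewrite /t Bj mul0r.
    rewrite mulr_sumr; apply: eq_bigr => j Bj; rewrite /t Bj.
    have := sqrr_sign R (f j); set e := (-1) ^+ f j => e1; ring: e1.
  apply: le_trans (count_small_signs (t := t) I0 _ _ _ _ Ts); last first.
  - move=> i i' ii'; rewrite t2; apply: le_trans (ler_norm _) _.
    by rewrite !normrM !normr_sign !mul1r xeta.
  - move=> i; under eq_bigr do rewrite expr2.
    by rewrite t2 -expr2 sqrr_sign mul1r; under eq_bigr do rewrite -expr2; case/andP: (sV i).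
  - move=> i; under eq_bigr do rewrite expr2.
    by rewrite t2 -expr2 sqrr_sign mul1r; under eq_bigr do rewrite -expr2; case/andP: (sV i).
  - move=> i j; rewrite /t; case: ifPn => Bj; rewrite ?normr0//.
    by rewrite !normrM !normr_sign mul1r mulr1 x1.
  rewrite ler_nat; apply: subset_leq_card; apply/fintype.subsetP => h.
  rewrite !inE => /forallP Fh; apply/forallP => i.
  have -> : \sum_j t i j * (-1) ^+ h j =
      (-1) ^+ (y i < 0)%R * (\sum_j x i j * (-1) ^+ flip h f j) - `|y i|.
    rewrite (bigID B)/= [X in _ + X]big1 ?addr0; last first.
      by move=> j /negbTE Bj; rewrite /t Bj mul0r.
    rewrite [in RHS](bigID B)/= mulrDr.
    have -> : \sum_(j | ~~ B j) x i j * (-1) ^+ flip h f j = y i.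
      by apply: eq_bigr => j /negbTE Bj; rewrite ffunE Bj addbF.
    rewrite -normrEsign ?num_real// addrK mulr_sumr; apply: eq_bigr => j Bj.
    by rewrite /t Bj ffunE Bj/= signr_addb !mulrA.
  apply: le_trans (Fh i); rewrite lerBlDr -[leLHS]addr0 lerD//.
  apply: le_trans (ler_norm _) _.
  by rewrite normrM normr_sign mul1r.
(* Double counting of the pairs [(h, f)] with [flip h f] in [F]: for fixed [h] there are [#|F|] of
   them, [flip h] being an involution. *)
have : 2 ^+ #|J| * #|F|%:R = \sum_f #|[pred h | F (flip h f)]|%:R :> R.
  transitivity (\sum_(h : {ffun J -> bool}) #|F|%:R : R).
    by rewrite sumr_const card_ffun card_bool -[RHS]mulr_natl natrX.
  have card_sum (p : pred {ffun J -> bool}) : #|p|%:R = \sum_f (p f)%:R :> R.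
    by rewrite -sum1_card natr_sum big_mkcond/=; apply: eq_bigr => f _; rewrite unfold_in; case: (p f).
  rewrite [RHS](eq_bigr _ (fun f _ => card_sum _)) [RHS]exchange_big/=.
  apply: eq_bigr => h _; rewrite card_sum (reindex_inj (inv_inj (flipK h))).
  by apply: eq_bigr.
move=> eqF; have J2 : 0 < 2 ^+ #|J| :> R by rewrite exprn_gt0.
rewrite -(ler_pM2l J2) eqF.
apply: le_trans (ler_sum _ (fun f _ => inner f)) _.
by rewrite sumr_const card_ffun card_bool -[leLHS]mulr_natl natrX.
Qed.

(** * Weighted cosine sums *)

Section TrigSums.
Variable R : realType.
Implicit Types (rho phi : R).

(* [(1 - 2 rho cos phi + rho^2) rho^j cos (j phi)] is a difference of
   consecutive terms of [rho^j cos (j phi) - rho^(j+1) cos ((j - 1) phi)]. *)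
Lemma sum_geometric_cos_le rho phi (p q : nat) : 0 <= rho <= 1 -> (p <= q)%N ->
  `|\sum_(p <= j < q) rho ^+ j * cos (j%:R * phi)| * (1 - 2 * rho * cos phi + rho ^+ 2)
    <= 4.
Proof.
move=> /andP[r0 r1] pq.
pose c (j : nat) := rho ^+ j * cos (j%:R * phi).
pose e (j : nat) := rho ^+ j.+1 * cos ((j%:R - 1) * phi).
pose D := 1 - 2 * rho * cos phi + rho ^+ 2.
have D0 : 0 <= D.
  have -> : D = (1 - rho) ^+ 2 + 2 * rho * (1 - cos phi) by rewrite /D; ring.
  by rewrite addr_ge0 ?sqr_ge0// !mulr_ge0// subr_ge0 cos_le1.
have ceD j : c j * D = - ((c j.+1 - e j.+1) - (c j - e j)).
  have cs : cos (j.+1%:R * phi) = cos (j%:R * phi) * cos phi - sin (j%:R * phi) * sin phi.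
    by rewrite -cosD -natr1 mulrDl mul1r.
  have cp : cos ((j%:R - 1) * phi) = cos (j%:R * phi) * cos phi + sin (j%:R * phi) * sin phi.
    by rewrite -cosB mulrBl mul1r.
  have e1 : e j.+1 = rho ^+ j.+2 * cos (j%:R * phi) by rewrite /e -natr1 addrK.
  by rewrite e1 /c /e /D cs cp !exprS; ring.
have norm_le1 j x : `|rho ^+ j * cos x| <= 1.
  by rewrite normrM mulr_ile1// ?cos_max// normrX ger0_norm// exprn_ile1.
rewrite -[X in _ * X](ger0_norm D0) -normrM mulr_suml.
rewrite (eq_bigr _ (fun j _ => ceD j)) sumrN telescope_sumr// normrN.
have -> : 4 = (1 + 1) + (1 + 1) :> R by ring.
by rewrite (le_trans (ler_normB _ _))// lerD// (le_trans (ler_normB _ _))// lerD//;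
  exact: norm_le1.
Qed.

Lemma one_sub_cos1_gt0 : 0 < 1 - cos 1 :> R.
Proof.
rewrite subr_gt0 -[ltRHS](@cos0 R) ltr_cos ?ltr01// in_itv/= ?lexx ?pi_ge0// ler01/=.
by apply: le_trans (pi_ge2 R); lra.
Qed.

(* By [1 - cos (2 x) <= 4 (1 - cos x)], halving the angle from 1. *)
Lemma one_sub_cos_ge (m : nat) phi : 2 ^- m <= `|phi| <= 2 ->
  1 - cos 1 <= 4 ^+ m * (1 - cos phi).
Proof.
move=> /andP[m1 m2].
have m0 : 0 < 2 ^- m :> R by rewrite invr_gt0 exprn_gt0.
have phipi : `|phi| <= pi := le_trans m2 (pi_ge2 R).
apply: (@le_trans _ _ (4 ^+ m * (1 - cos (2 ^- m)))); last first.
  rewrite ler_pM2l ?exprn_gt0// lerB// -(cos_norm phi) leNgt ltr_cos -?leNgt//.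
  - by rewrite in_itv/= normr_ge0.
  - by rewrite in_itv/= (ltW m0) (le_trans m1).
elim: m {m1 m0} => [|m IH]; first by rewrite !expr0 invr1 mul1r.
apply: le_trans IH _; rewrite exprSr -mulrA ler_pM2l ?exprn_gt0//.
have -> : 2 ^- m = (2 ^- m.+1) *+ 2 :> R.
  by rewrite exprS -[_ *+ 2]mulr_natr; field; rewrite expf_neq0.
rewrite cos_mulr2n -[_ *+ 2]mulr_natl.
by have := cos_le1 (2 ^- m.+1 : R); nra.
Qed.

(** The factor [1 - 2 rho cos phi + rho ^+ 2] is at least [2 rho (1 - cos phi)], hence at least
    [(1 - cos phi) / 2] when [rho >= 1/4]; this turns the constant 4 of [sum_geometric_cos_le] into
    8. *)
Lemma sum_geometric_cos_le_pow rho phi (m p q : nat) : 4^-1 <= rho <= 1 ->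
  2 ^- m <= `|phi| <= 2 -> (p <= q)%N ->
  `|\sum_(p <= j < q) rho ^+ j * cos (j%:R * phi)| <= 8 / (1 - cos 1) * 4 ^+ m.
Proof.
move=> /andP[r0 r1] phim pq; have k0 := one_sub_cos1_gt0.
have rho0 : 0 <= rho by apply: le_trans r0.
have := @sum_geometric_cos_le rho phi p q; rewrite rho0 r1 => /(_ isT pq).
set S := `|_| => SD; have S0 : 0 <= S by apply: normr_ge0.
have := one_sub_cos_ge phim; set k := 1 - cos 1 in k0 *; set M := 4 ^+ m => kM.
have M0 : 0 < M by apply: exprn_gt0.
rewrite mulrAC ler_pdivlMr//.
apply: (@le_trans _ _ (S * (M * (1 - cos phi)))); first by rewrite ler_wpM2l.
rewrite mulrCA [leRHS]mulrC ler_pM2l//.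
have c1 := cos_le1 phi.
have : 2 * rho * (1 - cos phi) <= 1 - 2 * rho * cos phi + rho ^+ 2.
  by have := sqr_ge0 (1 - rho); lra.
move=> /(ler_wpM2l S0)/le_trans/(_ SD).
have : 0 <= S * (1 - cos phi) by rewrite mulr_ge0// subr_ge0.
nra.
Qed.

End TrigSums.

(** * One frequency block *)

Section Block.
Variable R : realType.

(** With [x = 1/n <= 1/2], the product [(1 - x) (1 + 2 x)] is at least 1, so
    [1 - x >= (1 + 2 x)^-1 >= expR (- 2 x)]. This bounds below the smallest weight [r ^+ (2 n)] in a
    block. *)
Lemma one_subV_expn_ge (n : nat) : (2 <= n)%N ->
  expR (- 4) <= ((1 - n%:R^-1) ^+ 2) ^+ n :> R.
Proof.
move=> n2; have n0 : 0 < n%:R :> R by rewrite ltr0n (leq_trans _ n2).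
set x : R := n%:R^-1.
have x0 : 0 < x by rewrite invr_gt0.
have x2 : x <= 2^-1 by rewrite lef_pV2 ?posrE// ler_nat.
have -> : - 4 = (2 * n)%N%:R * - (2 * x) :> R.
  by rewrite natrM /x; field; rewrite gt_eqF.
rewrite expRM_natl -exprM lerXn2r// ?nnegrE ?expR_ge0//; first by lra.
rewrite expRN; apply: (@le_trans _ _ (1 + 2 * x)^-1).
  by rewrite lef_pV2 ?posrE ?expR_gt0 ?expR_ge1Dx//; lra.
by rewrite -[leLHS]mul1r ler_pdivrMr; nra.
Qed.

Lemma sum_ord_interval (N p n : nat) (F : nat -> R) : (n < N)%N ->
  \sum_(j < N | (p < j <= n)%N) F j = \sum_(p.+1 <= j < n.+1) F j.
Proof.
move=> nN; rewrite -(big_mkord (fun j => (p < j <= n)%N) F).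
rewrite (big_nat_widen _ _ _ _ _ nN) (big_nat_widenl _ _ _ _ _ (leq0n p.+1)).
by apply: eq_bigl => j; rewrite andTb andbC.
Qed.

Lemma cosM (x y : R) : cos x * cos y = (cos (x - y) + cos (x + y)) / 2.
Proof. by rewrite cosB cosD; field. Qed.

(** Starting at [i.+1] keeps 0 off the grid, so that sums of two grid points, like differences of
    distinct ones, have absolute value between [2 ^- m] and 2. *)
Definition grid (m : nat) (i : 'I_(2 ^ m)) : R := i.+1%:R / 2 ^+ m.

Lemma grid_itv m (i : 'I_(2 ^ m)) : 2 ^- m <= grid i <= 1.
Proof.
have m0 : 0 < 2 ^+ m :> R by rewrite exprn_gt0.
rewrite /grid ler_pdivrMr// mul1r -natrX ler_nat ltn_ord andbT.
by rewrite ler_peMl ?invr_ge0 ?ler0n// ler1n.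
Qed.

Lemma grid_dist m (i i' : 'I_(2 ^ m)) : i != i' -> 2 ^- m <= `|grid i - grid i'|.
Proof.
move=> ii'; rewrite /grid -mulrBl normrM.
rewrite [X in _ * X]ger0_norm ?invr_ge0 ?exprn_ge0//.
rewrite ler_peMl ?invr_ge0 ?exprn_ge0//.
wlog lt_ii' : i i' ii' / (i < i')%N => [H|].
  have [lt1|lt1] := ltnP i i'; first exact: H.
  rewrite distrC; apply: H; first by rewrite eq_sym.
  by rewrite ltn_neqAle lt1 andbT eq_sym; apply: contraNneq ii' => /val_inj ->.
rewrite distrC -natrB ?normr_nat ?ler1n ?subSS ?subn_gt0//.
by rewrite ltnS ltnW.
Qed.

(** The normalisation [tau] makes the square sums over the block comparable to [ln n]. The condition
    [p.*2 <= n] supplies at least [n / 2] frequencies for the lower bound, while [16 ^ m <= n] keeps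
    the oscillating sums, of size [C * 4 ^ m], of order at most the square root of [n]. *)
Lemma count_small_block (p n m N : nat) (a : nat -> R) (alpha T : R) :
  let r : R := 1 - n%:R^-1 in
  let C : R := 8 / (1 - cos 1) in
  let tau : R := Num.sqrt (ln n%:R / (8 * n%:R)) in
  (2 <= n)%N -> (p.*2 <= n)%N -> (n < N)%N -> (16 ^ m <= n)%N ->
  0 < alpha -> (forall j, (p < j <= n)%N -> a j = alpha) ->
  4 * C * expR 4 <= 4 ^+ m ->
  expR (tau * T / alpha - expR (- 4) / 512 * ln n%:R) <= 2^-1 ->
  #|[pred f : {ffun 'I_N -> bool} | [forall i : 'I_(2 ^ m),
      `|\sum_(j < N) a j * r ^+ j * cos (j%:R * grid i) * (-1) ^+ f j| <= T]]|%:R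
  <= 4 * (expR (ln n%:R / 8) / 2 ^+ m + expR (C * 4 ^+ m * ln n%:R / (8 * n%:R)) - 1)
     * 2 ^+ N.
Proof.
move=> r C tau n2 pn nN mn a0 aB HC HT.
set L := ln n%:R in tau HT *.
have n0 : 0 < n%:R :> R by rewrite ltr0n (leq_trans _ n2).
have n0' : n%:R != 0 :> R by rewrite gt_eqF.
have L0 : 0 <= L by rewrite ln_ge0// ler1n (leq_trans _ n2).
have Ln : L < n%:R by apply: ln_sublinear.
have tau0 : 0 <= tau by apply: sqrtr_ge0.
have tau2 : tau ^+ 2 = L / (8 * n%:R).
  by rewrite sqr_sqrtr// divr_ge0// mulr_ge0// ltW.
have tau1 : tau <= 1.
  rewrite -[leRHS](@sqrtr1 R) ler_sqrt// ler_pdivrMr ?mulr_gt0// mul1r.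
  by apply: ltW; nra.
have nV2 : n%:R^-1 <= 2^-1 :> R by rewrite lef_pV2 ?posrE// ler_nat.
have nV0 : 0 < n%:R^-1 :> R by rewrite invr_gt0.
have r12 : 2^-1 <= r <= 1 by rewrite /r; lra.
have r01 : 0 <= r <= 1 by case/andP: r12 => ? ?; apply/andP; split; lra.
pose rho := r ^+ 2.
have rho14 : 4^-1 <= rho <= 1 by case/andP: r12 => ? ?; rewrite /rho; apply/andP; split; nra.
pose x (i : 'I_(2 ^ m)) (j : 'I_N) :=
  tau / alpha * (a j * r ^+ j * cos (j%:R * grid i)).
pose B (j : 'I_N) := (p < j <= n)%N.
have C0 : 0 < C by rewrite /C divr_gt0// one_sub_cos1_gt0.
(* The product of two cosines splits into the cosines of the difference and of the sum of the
   angles. Only the difference can vanish, and it does so exactly on the diagonal. *)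
pose Q (i i' : 'I_(2 ^ m)) := \sum_(p.+1 <= j < n.+1)
  rho ^+ j * (cos (j%:R * (grid i - grid i')) + cos (j%:R * (grid i + grid i'))).
have xB i j : B j -> x i j = tau * (r ^+ j * cos (j%:R * grid i)).
  by move=> Bj; rewrite /x aB//; field; rewrite gt_eqF.
have xx i i' : \sum_(j | B j) x i j * x i' j = L / (16 * n%:R) * Q i i'.
  transitivity (\sum_(j : 'I_N | B j) L / (16 * n%:R) *
      (rho ^+ j * (cos (j%:R * (grid i - grid i')) + cos (j%:R * (grid i + grid i'))))).
    apply: eq_bigr => j Bj; rewrite !xB// !mulrBr !mulrDr.
    have -> : L / (16 * n%:R) = tau ^+ 2 / 2 by rewrite tau2; field.
    have := cosM (j%:R * grid i) (j%:R * grid i').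
    rewrite /rho exprAC; set u := cos _; set w := cos (j%:R * grid i').
    rewrite expr2 => uw.
    transitivity (tau ^+ 2 * (r ^+ j * r ^+ j) * (u * w)); first by ring.
    by rewrite uw; field.
  rewrite -mulr_sumr; congr (_ * _); exact: (sum_ord_interval p (fun j => rho ^+ j *
    (cos (j%:R * (grid i - grid i')) + cos (j%:R * (grid i + grid i')))) nN).
have card2 : #|'I_(2 ^ m)|%:R = 2 ^+ m :> R by rewrite card_ord natrX.
have pn1 : (p.+1 <= n.+1)%N.
  by rewrite ltnS (leq_trans _ pn)// -addnn leq_addr.
have gi (i : 'I_(2 ^ m)) : 0 < grid i :> R.
  by apply: lt_le_trans (proj1 (andP (@grid_itv m i))); rewrite invr_gt0 exprn_gt0.
have sumcos phi : 2 ^- m <= `|phi| <= 2 ->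
    `|\sum_(p.+1 <= j < n.+1) rho ^+ j * cos (j%:R * phi)| <= C * 4 ^+ m.
  by move=> h; apply: sum_geometric_cos_le_pow.
have gridD (i i' : 'I_(2 ^ m)) : 2 ^- m <= `|grid i + grid i'| <= 2.
  have /andP[? ?] := @grid_itv m i; have /andP[? ?] := @grid_itv m i'.
  rewrite (ger0_norm (addr_ge0 (ltW (gi i)) (ltW (gi i')))); apply/andP; split; last by lra.
  by have := gi i'; lra.
have Qoff i i' : i != i' -> `|Q i i'| <= 2 * (C * 4 ^+ m).
  move=> ii'; rewrite /Q; under eq_bigr do rewrite mulrDr.
  rewrite big_split/= mulr_natl mulr2n (le_trans (ler_normD _ _))// lerD//.
    apply: sumcos; rewrite grid_dist//= (le_trans (ler_normB _ _))//.
    have /andP[? ?] := @grid_itv m i; have /andP[? ?] := @grid_itv m i'.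
    by rewrite (ger0_norm (ltW (gi i))) (ger0_norm (ltW (gi i'))); lra.
  exact: sumcos.
have rho0 : 0 <= rho by rewrite sqr_ge0.
have rhoj j : 0 <= rho ^+ j <= 1.
  by rewrite exprn_ge0//= exprn_ile1//; case/andP: rho14.
have Qdiag i : n%:R * expR (- 4) / 4 <= Q i i <= 2 * n%:R.
  apply/andP; split; last first.
    apply: (@le_trans _ _ (\sum_(p.+1 <= j < n.+1) 2)).
      apply: ler_sum => j _; case/andP: (rhoj j) => ? ?.
      rewrite subrr mulr0 cos0.
      by have := cos_le1 (j%:R * (grid i + grid i)); nra.
    by rewrite sumr_const_nat subSS -[leLHS]mulr_natr ler_pM2l// ler_nat leq_subr.
  rewrite /Q; under eq_bigr do rewrite mulrDr subrr mulr0 cos0 mulr1.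
  rewrite big_split/=.
  have h1 : n%:R / 2 * expR (- 4) <= \sum_(p.+1 <= j < n.+1) rho ^+ j.
    apply: (@le_trans _ _ (\sum_(p.+1 <= j < n.+1) expR (- 4))).
      rewrite sumr_const_nat subSS -[leRHS]mulr_natl ler_pM2r ?expR_gt0//.
      rewrite ler_pdivrMr// -natrM ler_nat mulnBl.
      by rewrite leq_subRL ?muln2// -?addnn ?leq_add2r ?addnn// leq_double.
    rewrite !big_nat; apply: ler_sum => j /andP[_ jn].
    apply: le_trans (one_subV_expn_ge n2) _.
    by rewrite ler_wiXn2l//; case/andP: rho14.
  have := sumcos _ (gridD i i); rewrite ler_norml => /andP[h2 _].
  (* The oscillating part is at most half of the lower bound [h1] for the main part, so half of that
     bound survives in [Q i i]. *)
  have h3 : C * 4 ^+ m <= n%:R * expR (- 4) / 4.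
    have h4 : 4 ^+ m * 4 ^+ m <= n%:R :> R.
      by rewrite -exprMn -natrM -natrX ler_nat.
    have e1 : expR 4 * expR (- 4) = 1 :> R by rewrite -expRD subrr expR0.
    have e0 : 0 < expR (- 4) :> R := expR_gt0 _.
    have m0 : 0 < 4 ^+ m :> R by rewrite exprn_gt0.
    have h5 : 4 * C <= 4 ^+ m * expR (- 4).
      have -> : 4 * C = 4 * C * expR 4 * expR (- 4) by rewrite -[RHS]mulrA e1 mulr1.
      by rewrite ler_pM2r.
    have h6 : 4 * C * 4 ^+ m <= 4 ^+ m * expR (- 4) * 4 ^+ m by rewrite ler_pM2r.
    have h7 := h4; rewrite -(ler_pM2r e0) in h7.
    lra.
  lra.
rewrite -card2 -[X in 2 ^+ X](card_ord N).
(* Multiplying the bounds of [Qdiag] by [L / (16 n)] gives [s = expR (- 4) / 64 * L] and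
   [V = L / 8]; the 512 in the hypothesis on [T] is 8 times 64. *)
apply: le_trans (count_small_sums (x := x) (B := B) (T := tau * T / alpha)
   (s := expR (- 4) / 64 * L) _ _ _ _ _).
- rewrite ler_nat; apply: subset_leq_card; apply/fintype.subsetP => f.
  rewrite !inE => /forallP Tf; apply/forallP => i.
  have -> : \sum_j x i j * (-1) ^+ f j =
      tau / alpha * (\sum_(j < N) a j * r ^+ j * cos (j%:R * grid i) * (-1) ^+ f j).
    by rewrite mulr_sumr; apply: eq_bigr => j _; rewrite /x !mulrA.
  rewrite normrM ger0_norm ?divr_ge0 ?(ltW a0)// mulrAC.
  by rewrite ler_pM2r ?invr_gt0// ler_wpM2l.
- by rewrite card_ord expn_gt0.
- move=> i j Bj; rewrite xB// normrM ger0_norm// mulr_ile1//.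
  rewrite normrM mulr_ile1// ?cos_max// ger0_norm ?exprn_ge0 ?exprn_ile1//;
  by case/andP: r01.
- move=> i; under eq_bigr do rewrite expr2.
  rewrite xx; have /andP[q1 q2] := Qdiag i.
  have c0 : 0 <= L / (16 * n%:R) by rewrite divr_ge0// mulr_ge0// ltW.
  apply/andP; split.
    apply: le_trans (ler_wpM2l c0 q1); rewrite le_eqVlt; apply/orP; left; apply/eqP.
    by field.
  apply: le_trans (ler_wpM2l c0 q2) _; rewrite le_eqVlt; apply/orP; left; apply/eqP.
  by field.
- move=> i i' ii'; rewrite xx normrM.
  have c0 : 0 <= L / (16 * n%:R) by rewrite divr_ge0// mulr_ge0// ltW.
  rewrite ger0_norm//; apply: le_trans (ler_wpM2l c0 (Qoff _ _ ii')) _.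
  rewrite le_eqVlt; apply/orP; left; apply/eqP.
  by field.
- apply: le_trans HT; rewrite ler_expR lerB// le_eqVlt; apply/orP; left; apply/eqP.
  by field.
Qed.

End Block.

(** * Choice of the block and of the grid size *)

Section Asymptotics.
Variable R : realType.

(** With [y = 2 ^+ m], [n] lies between [y ^+ 4] and [16 y ^+ 4]. Thus [n ^ (1/8)] is of order
    [sqrt y], negligible against [y], and since [ln n <= 4 y] the second exponent is of order at
    most [1 / y]. *)
Lemma block_error_le (n m : nat) (C delta : R) :
  (16 ^ m <= n < 16 ^ m.+1)%N -> 0 < delta <= 2^-1 -> 0 < C ->
  2 / delta ^+ 2 <= 2 ^+ m -> C / delta <= 2 ^+ m ->
  expR (ln n%:R / 8) / 2 ^+ m + expR (C * 4 ^+ m * ln n%:R / (8 * n%:R)) - 1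
    <= 3 * delta.
Proof.
move=> /andP[mn nm] /andP[d0 d1] C0 dm Cm; set L : R := ln n%:R.
have n0 : 0 < n%:R :> R by rewrite ltr0n (leq_trans _ mn)// expn_gt0.
have y0 : 0 < 2 ^+ m :> R by rewrite exprn_gt0.
set y := 2 ^+ m in dm Cm y0 *.
have y4 : 4 ^+ m = y ^+ 2 :> R.
  by rewrite /y exprAC; congr (_ ^+ _); ring.
have ym : m.+1%:R <= y by rewrite /y -natrX ler_nat ltn_expl.
have ny : y ^+ 4 <= n%:R.
  by rewrite /y exprAC -!natrX ler_nat.
have L1 : L <= 4 * m.+1%:R :> R.
  apply: (@le_trans _ _ (ln ((2 ^+ (4 * m.+1)) : R))).
    rewrite /L ler_ln ?posrE ?exprn_gt0// -natrX ler_nat expnM.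
    exact: ltnW.
  rewrite lnXn// -[leLHS]mulr_natr natrM mulrC ler_piMr ?mulr_ge0//.
  by have := @ln_sublinear R 2 (ltr0n _ 2); have := @le_ln1Dx R 1; lra.
have d2 : 0 < delta ^+ 2 by rewrite exprn_gt0.
(* Eighth powers are compared: [n <= 16 y ^+ 4], and [2 <= delta ^+ 2 * y] gives
   [16 <= (delta ^+ 2 * y) ^+ 4]. *)
have le1 : expR (L / 8) <= delta * y.
  have X0 : 0 <= expR (L / 8) by apply: expR_ge0.
  rewrite -(@ler_pXn2r _ 8) ?nnegrE ?mulr_ge0 ?(ltW d0) ?(ltW y0)//.
  rewrite -expRM_natl mulrCA divff// mulr1 /L lnK ?posrE//.
  have : n%:R <= 16 * y ^+ 4 :> R.
    rewrite /y exprAC -!natrX -natrM ler_nat; apply: ltnW.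
    by rewrite expnS in nm.
  move=> /le_trans; apply.
  have : 2 <= delta ^+ 2 * y by rewrite mulrC -ler_pdivrMr.
  have dy0 : 0 <= delta ^+ 2 * y by apply/ltW/mulr_gt0.
  rewrite -(@ler_pXn2r _ 4) ?nnegrE//.
  have -> : 2 ^+ 4 = 16 :> R by ring.
  have -> : (delta * y) ^+ 8 = (delta ^+ 2 * y) ^+ 4 * y ^+ 4 by ring.
  by move=> ?; rewrite ler_pM2r ?exprn_gt0.
have le2 : C * 4 ^+ m * L / (8 * n%:R) <= delta.
  rewrite ler_pdivrMr ?mulr_gt0// y4.
  have L2 : L <= 4 * y :> R by apply: le_trans L1 _; rewrite ler_pM2l.
  have {}Cm : C <= delta * y by rewrite mulrC -ler_pdivrMr.
  apply: (@le_trans _ _ (C * y ^+ 2 * (4 * y))).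
    by rewrite ler_pM2l// mulr_gt0// exprn_gt0.
  apply: (@le_trans _ _ (delta * y * y ^+ 2 * (4 * y))).
    by rewrite ler_pM2r ?mulr_gt0// ler_pM2r ?exprn_gt0.
  have : delta * y ^+ 4 <= delta * n%:R by rewrite ler_pM2l.
  have : 0 < delta * n%:R by rewrite mulr_gt0.
  have -> : delta * y * y ^+ 2 * (4 * y) = 4 * (delta * y ^+ 4) by ring.
  lra.
(* For [delta <= 1/2], [expR delta <= (1 - delta)^-1 <= 1 + 2 * delta]. *)
have le3 : expR (C * 4 ^+ m * L / (8 * n%:R)) <= 1 + 2 * delta.
  apply: (@le_trans _ _ (expR delta)); first by rewrite ler_expR.
  have := expR_ge1Dx (- delta); rewrite expRN => h.
  have e0 : 0 < expR delta by apply: expR_gt0.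
  have : (1 - delta) * expR delta <= 1 by rewrite -ler_pdivlMr// mul1r.
  nra.
have : expR (L / 8) / y <= delta by rewrite ler_pdivrMr.
lra.
Qed.

(** The block [k] and the grid are fixed before [N]: the bound on [u] is only seen through its
    partial sums of large length, so the count must be small for all large [N] at once. *)
Lemma exists_small_block (n : nat -> nat) (nu G a : nat -> R) (K eps : R) :
  (forall k, ((n k).*2 < n k.+1)%N) -> (forall k, 0 < G k) ->
  nu k @[k --> \oo] --> +oo -> (forall k, 0 < nu k) ->
  (forall j k, (3 <= j)%N -> (1 <= k)%N -> (n k.-1 < j <= n k)%N ->
      a j = nu k * (G k / Num.sqrt ((n k)%:R * ln (n k)%:R))) ->
  0 < K -> 0 < eps ->
  exists k m, (2 <= n k)%N /\
    forall N, (n k < N)%N ->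
    #|[pred f : {ffun 'I_N -> bool} | [forall i : 'I_(2 ^ m),
      `|\sum_(j < N) a j * (1 - (n k)%:R^-1) ^+ j * cos (j%:R * grid R i) * (-1) ^+ f j|
        <= K * G k]]|%:R <= eps * 2 ^+ N.
Proof.
move=> n2 G0 nuoo nu0 aE K0 eps0.
have nk k : (k <= n k)%N.
  elim: k => // k IH; apply: leq_ltn_trans (n2 k).
  by rewrite -addnn (leq_trans IH) ?leq_addr.
pose C : R := 8 / (1 - cos 1).
have C0 : 0 < C by rewrite /C divr_gt0// one_sub_cos1_gt0.
pose c : R := expR (- 4) / 512.
have c0 : 0 < c.
  by apply: divr_gt0; [exact: expR_gt0|rewrite ltr0n].
(* The final error is [4 * (3 * delta)], whence [eps / 12]. *)
pose delta := Num.min 2^-1 (eps / 12).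
have d0 : 0 < delta by rewrite lt_min invr_gt0 ltr0n/= divr_gt0.
have d1 : delta <= 2^-1 by rewrite ge_min lexx.
have d2 : delta <= eps / 12 by rewrite ge_min lexx orbT.
pose Y := Num.max (4 * C * expR 4) (Num.max (2 / delta ^+ 2) (C / delta)).
have [M YM] : exists M, Y <= 2 ^+ M.
  exists (Num.bound Y); apply: le_trans (ltW (archi_boundP _)) _.
    by rewrite le_max mulr_ge0 ?mulr_ge0 ?expR_ge0// ltW.
  by rewrite -natrX ler_nat ltnW// ltn_expl.
(* Large [nu k] brings the normalised threshold below [c / 2 * L], and [2 / c <= L] makes the
   remaining exponent at most -1. As [k <= n k], the bound [5 <= k] also places the whole block at
   indices [j >= 3], where the formula for [a j] applies. *)
have [k [nuk [nk2 [nkM Lk]]]] : exists k, 2 * K / c <= nu k /\ (5 <= k)%N /\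
    (16 ^ M <= n k)%N /\ 2 / c <= ln (n k)%:R.
  near \oo => k; exists k; split; last split; last split.
  - by near: k; apply: cvgry_ge.
  - by near: k; exact: nbhs_infty_ge.
  - by apply: leq_trans (nk k); near: k; exact: nbhs_infty_ge.
  - rewrite -[leLHS]expRK ler_ln ?posrE ?expR_gt0//.
      apply: (@le_trans _ _ k%:R); last by rewrite ler_nat.
      by near: k; exact: nbhs_infty_ger.
    rewrite ltr0n; apply: leq_trans (nk k).
    by near: k; exact: nbhs_infty_ge.
have nk5 : (5 <= n k)%N := leq_trans nk2 (nk k).
pose m := trunc_log 16 (n k).
have /andP[m1 m2] : (16 ^ m <= n k < 16 ^ m.+1)%N.
  by apply: trunc_log_bounds => //; exact: leq_trans nk5.
have Mm : (M <= m)%N by apply: trunc_log_max.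
have {}YM : Y <= 2 ^+ m by apply: le_trans YM _; rewrite ler_eXn2l// ltr1n.
move: YM; rewrite !ge_max => /andP[Y1 /andP[Y2 Y3]].
set L := ln (n k)%:R in Lk.
have n0 : 0 < (n k)%:R :> R by rewrite ltr0n (leq_trans _ nk5).
have L0 : 0 < L by apply: lt_le_trans Lk; rewrite divr_gt0.
pose alpha := nu k * (G k / Num.sqrt ((n k)%:R * L)).
have s0 : 0 < Num.sqrt ((n k)%:R * L) by rewrite sqrtr_gt0 mulr_gt0.
have alpha0 : 0 < alpha by rewrite mulr_gt0// divr_gt0.
exists k, m; split=> [|N nN]; first exact: leq_trans nk5.
apply: le_trans (count_small_block (p := n k.-1) (alpha := alpha) _ _ nN m1 alpha0 _ _ _) _.
- exact: leq_trans nk5.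
- by rewrite -[in leqRHS](prednK (leq_trans _ nk2))// ltnW.
- move=> j jn; apply: aE => //; last exact: leq_trans nk2.
  case/andP: jn => jn _; apply: leq_ltn_trans jn.
  by apply: leq_trans (nk _); rewrite -ltnS prednK ?(leq_trans _ nk2).
- apply: le_trans Y1 _.
  by rewrite lerXn2r ?nnegrE ?ler_nat.
- rewrite -/L -/c.
  have h : Num.sqrt (L / (8 * (n k)%:R)) * (K * G k) / alpha <= c / 2 * L.
    have -> : Num.sqrt (L / (8 * (n k)%:R)) * (K * G k) / alpha =
        K / nu k * (Num.sqrt (L / (8 * (n k)%:R)) * Num.sqrt ((n k)%:R * L)).
      by rewrite /alpha; field; rewrite !gt_eqF.
    apply: ler_pM.
    - by rewrite divr_ge0// ltW.
    - by rewrite mulr_ge0 ?sqrtr_ge0.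
    - rewrite ler_pdivrMr//.
      by move: nuk; rewrite ler_pdivrMr//; lra.
    - rewrite -sqrtrM; last by rewrite divr_ge0 ?mulr_ge0// ltW.
      rewrite -[leRHS](gtr0_norm L0) -sqrtr_sqr ler_wsqrtr//.
      have -> : L / (8 * (n k)%:R) * ((n k)%:R * L) = L ^+ 2 / 8.
        by field; rewrite gt_eqF.
      by have := sqr_ge0 L; lra.
  have cL : 1 <= c / 2 * L.
    by move: Lk; rewrite ler_pdivrMr//; lra.
  apply: (@le_trans _ _ (expR (- 1))); first by rewrite ler_expR; lra.
  rewrite expRN lef_pV2 ?posrE ?expR_gt0//.
  by have := expR_ge1Dx (1 : R); lra.
rewrite ler_pM2r ?exprn_gt0//.
have := @block_error_le (n k) m C delta.
rewrite m1 m2 d0 d1 => /(_ isT isT C0 Y2 Y3).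
rewrite -/L /C; lra.
Unshelve. all: by end_near. Qed.

End Asymptotics.

(** * From counting signs to almost sure statements *)

Section Rademacher.
Context (d : measure_display) (T : measurableType d) (R : realType)
  (P : probability T R).

Lemma measure_big_setU_le (I : Type) (s : seq I) (A : I -> set T) :
  (forall i, measurable (A i)) ->
  (P (\big[setU/set0]_(i <- s) A i) <= \sum_(i <- s) P (A i))%E.
Proof.
move=> mA; elim: s => [|i s IH]; first by rewrite !big_nil measure0.
rewrite !big_cons; apply: le_trans (leeD2l _ IH).
by apply: measureU2 => //; apply: bigsetU_measurable.
Qed.

(** The intersections over [N >= M] increase with [M] and each lies in [G M], so continuity from
    below carries the bound to their union. *)
Lemma probability_liminf_le (G : (set T)^nat) (N0 : nat) (p : R) :
  (forall N, measurable (G N)) ->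
  (forall N, (N0 <= N)%N -> (P (G N) <= p%:E)%E) ->
  (P (\bigcup_M \bigcap_(N in [set N | (M <= N)%N]) G N) <= p%:E)%E.
Proof.
move=> mG Gp.
pose H M := \bigcap_(N in [set N | (M <= N)%N]) G N.
have mH M : measurable (H M) by apply: bigcap_measurable => //; exists M => /=.
have cH : P \o H @ \oo --> P (\bigcup_M H M).
  apply: nondecreasing_cvg_mu => //; first exact: bigcupT_measurable.
  move=> M M' MM'; apply/subsetPset => w Hw N /= M'N; apply: Hw.
  exact: leq_trans M'N.
rewrite -(cvg_lim _ cH)//; apply: lime_le; first by apply/cvg_ex; eexists; exact: cH.
exists N0 => // M /= N0M; apply: le_trans (Gp _ N0M).
by apply: le_measure; rewrite ?inE//; apply: bigcap_inf => /=.
Qed.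

(** The set [A] may be nonmeasurable; its measurable null cover is the intersection of covers of
    measure at most [1 / (q + 1)]. *)
Lemma negligible_le_eps (A : set T) :
  (forall eps : R, 0 < eps ->
    exists H, [/\ measurable H, A `<=` H & (P H <= eps%:E)%E]) ->
  P.-negligible A.
Proof.
move=> AH.
have /choice[H HP] : forall q : nat, exists H,
    [/\ measurable H, A `<=` H & (P H <= (q.+1%:R^-1)%:E)%E].
  by move=> q; apply: AH; rewrite invr_gt0.
have mH : measurable (\bigcap_q H q).
  by apply: bigcapT_measurable => q; have [] := HP q.
exists (\bigcap_q H q); split=> //; last by move=> w Aw q _; have [_ + _] := HP q; exact.
apply/eqP; rewrite eq_le measure_ge0 andbT; apply/lee_addgt0Pr => e e0; rewrite add0e.
have [q qe] : exists q : nat, q.+1%:R^-1 <= e.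
  exists (Num.bound e^-1); rewrite -[leRHS]invrK lef_pV2 ?posrE ?invr_gt0//.
  have /archi_boundP/ltW/le_trans -> // : 0 <= e^-1 by rewrite invr_ge0 ltW.
  by rewrite ler_nat.
have [mHq _ PHq] := HP q.
apply: le_trans (_ : (P (H q) <= _)%E); first by apply: le_measure; rewrite ?inE//; exact: bigcap_inf.
by apply: le_trans PHq _; rewrite lee_fin.
Qed.

Variables (xi : nat -> {RV P >-> R}).
Hypothesis xiP : rademacher_sequence xi.

Lemma measurable_preimage1 j (c : R) : measurable (xi j @^-1` [set c]).
Proof. exact: measurable_funPTI. Qed.

Definition signs_event (N : nat) (f : {ffun 'I_N -> bool}) : set T :=
  \bigcap_(j : 'I_N) xi j @^-1` [set (-1) ^+ f j].

Lemma measurable_signs_event N (f : {ffun 'I_N -> bool}) : measurable (signs_event f).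
Proof.
by apply: fin_bigcap_measurable => // j _; exact: measurable_preimage1.
Qed.

Lemma probability_signs_event N (f : {ffun 'I_N -> bool}) :
  P (signs_event f) = ((2 ^+ N)^-1)%:E.
Proof.
have [indep half] := xiP.
(* Independence is stated for variables indexed by all naturals, so [f] is padded with [false]
   beyond [N]. *)
pose b j := if insub j is Some i then f i else false.
have -> : signs_event f = \bigcap_(j in [set` iota 0 N]) xi j @^-1` [set (-1) ^+ b j].
  apply/seteqP; split => w Hw j /=.
    rewrite mem_iota/= add0n => jN.
    by have := Hw (Ordinal jN) I; rewrite /= /b insubT.
  by move=> _; have := Hw j; rewrite /= mem_iota/= add0n /b valK => ->.
rewrite indep ?iota_uniq//.
have halfb j : P (xi j @^-1` [set (-1) ^+ b j]) = (2^-1)%:E.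
  by have [h1 h2] := half j; case: (b j); rewrite ?expr1 ?expr0.
rewrite (eq_bigr (fun=> (2^-1)%:E)) => [|j _]; last exact: halfb.
by rewrite prodEFin big_const_seq count_predT size_iota -exprVn iter_mulr_1.
Qed.

(** The variables are real-valued and may differ from both signs somewhere, but the two disjoint
    events of probability 1/2 leave only a null set. *)
Lemma ae_rademacher_sign :
  P.-negligible (~` [set w | forall j, exists b : bool, xi j w = (-1) ^+ b]).
Proof.
pose A j := ~` (xi j @^-1` [set 1] `|` xi j @^-1` [set -1]).
apply: (@negligibleS _ _ _ _ (\bigcup_j A j)).
  move=> w /= /existsNP[j nj]; exists j => //= -[/= e|/= e]; apply: nj.
    by exists false.
  by exists true.
apply: negligible_bigcup => j; have [h1 h2] := xiP.2 j.
have mA : measurable (A j).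
  by apply: measurableC; apply: measurableU; exact: measurable_preimage1.
suff PA : P (A j) = 0%E by apply/negligibleP.
have PU : P (xi j @^-1` [set 1] `|` xi j @^-1` [set -1]) = ((2^-1)%:E + (2^-1)%:E)%E.
  rewrite -{1}h1 -h2; apply: measureU; [exact: measurable_preimage1..|].
  apply/seteqP; split => // w /= [-> /eqP].
  by rewrite -addr_eq0 -mulr2n pnatr_eq0.
rewrite /A probability_setC; last by apply: measurableU; exact: measurable_preimage1.
have half2 : 2^-1 + 2^-1 = 1 :> R by field.
rewrite PU -EFinD half2. by rewrite subrr.
Qed.

Lemma probability_some_signs_le N (F : pred {ffun 'I_N -> bool}) (p : R) :
  #|F|%:R <= p * 2 ^+ N ->
  (P (\big[setU/set0]_(f in F) signs_event f) <= p%:E)%E.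
Proof.
move=> Fp; rewrite -big_enum/=.
apply: le_trans (measure_big_setU_le _ (@measurable_signs_event N)) _.
rewrite (eq_bigr (fun=> ((2 ^+ N)^-1)%:E)) => [|f _]; last exact: probability_signs_event.
rewrite sumEFin lee_fin big_enum/= sumr_const -[leLHS]mulr_natl.
by rewrite ler_pdivrMr ?exprn_gt0.
Qed.

(* [A] lies, up to a null set, in [liminf_N G N] with [G N] determined by the
   first [N] signs, so counting sign vectors suffices. *)
Lemma negligible_rademacher (A : set T) :
  (forall eps : R, 0 < eps -> exists N0 (F : forall N, pred {ffun 'I_N -> bool}),
    (forall N, (N0 <= N)%N -> #|F N|%:R <= eps * 2 ^+ N) /\
    (forall w, A w -> (forall j, exists b : bool, xi j w = (-1) ^+ b) ->
      \forall N \near \oo, exists2 f : {ffun 'I_N -> bool},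
        f \in F N & forall j : 'I_N, xi j w = (-1) ^+ f j)) ->
  P.-negligible A.
Proof.
move=> AF; set S := [set w | forall j, exists b : bool, xi j w = (-1) ^+ b].
apply: (@negligibleS _ _ _ _ ((A `&` S) `|` ~` S)).
  by move=> w Aw; have [Sw|Sw] := pselect (S w); [left|right].
apply: negligibleU; last exact: ae_rademacher_sign.
apply: negligible_le_eps => eps /AF[N0 [F [Fe FA]]].
pose G N := \big[setU/set0]_(f in F N) signs_event f.
have mG N : measurable (G N).
  by apply: bigsetU_measurable => f _; exact: measurable_signs_event.
exists (\bigcup_M \bigcap_(N in [set N | (M <= N)%N]) G N); split.
- by apply: bigcupT_measurable => M; apply: bigcap_measurable => //; exists M => /=.
- move=> w [Aw Sw]; have [M _ HM] := FA w Aw Sw.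
  exists M => // N /HM[f fF fw]; rewrite /G (bigD1 f)//=; left => j _.
  exact: fw.
- apply: (probability_liminf_le (N0 := N0)) => // N /Fe.
  exact: probability_some_signs_le.
Qed.

End Rademacher.

(** * The weight *)

Section Weight.
Variables (R : realType) (v : R -> R).
Hypothesis hv : doubling_weight v.
Let g := weight_g v.

Lemma one_subV_itv (x : R) : 1 <= x -> 0 <= 1 - x^-1 < 1.
Proof.
move=> x1; have x0 : 0 < x by apply: lt_le_trans x1.
by rewrite subr_ge0 invf_le1// x1 ltrBlDr ltrDl invr_gt0.
Qed.

Lemma weight_g_gt0 (x : R) : 1 <= x -> 0 < g x.
Proof. by move=> x1; apply: (weight_gt0 hv); apply: one_subV_itv. Qed.

Lemma weight_g_nondecreasing (x y : R) : 1 <= x -> x <= y -> g x <= g y.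
Proof.
move=> x1 xy; have y1 := le_trans x1 xy.
have /andP[? _] := one_subV_itv x1; have /andP[_ ?] := one_subV_itv y1.
apply: (weight_nondecreasing hv) => //.
by rewrite lerB// lef_pV2// posrE (lt_le_trans _ x1, lt_le_trans _ y1).
Qed.

Lemma weight_g_doubling : exists2 D, 0 <= D & forall x : R, 1 <= x -> g (2 * x) <= D * g x.
Proof.
have [D hD] := weight_doubling hv.
have Dx (x : R) : 1 <= x -> g (2 * x) <= D * g x.
  move=> x1; have x0 : 0 < x by apply: lt_le_trans x1.
  have := hD (2 * x)^-1; rewrite invr_gt0 mulr_gt0//= => hx.
  have -> : g x = v (1 - 2 * (2 * x)^-1).
    by rewrite /g /weight_g; congr (v (_ - _)); field; rewrite gt_eqF.
  by apply: hx; rewrite lef_pV2 ?posrE ?mulr_gt0//; lra.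
exists D => //; have := Dx _ (lexx 1).
have : 0 < g 1 by apply: weight_g_gt0.
have : 0 < g (2 * 1) by apply: weight_g_gt0; lra.
by move=> h2 h1 h; rewrite -(pmulr_lge0 _ h1) (le_trans (ltW h2)).
Qed.

(** An integer bound makes the union over all bounds countable. The extra unit in [K.+1] absorbs the
    distance from a partial sum to the limit, because [v r >= v 0 = 1]. *)
Lemma cos_series_in_hv_bounded (b : nat -> R) : cos_series_in_hv v b ->
  exists K : nat, forall r theta : R, 0 <= r < 1 -> \forall N \near \oo,
    `|\sum_(j < N) b j * r ^+ j * cos (j%:R * theta)| <= K.+1%:R * v r.
Proof.
move=> [u [_ [K K0 uK]] cu]; exists (Num.bound K) => r theta r01.
have r0 : 0 <= r by case/andP: r01.
have v1 : 1 <= v r.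
  by rewrite -(weight0 hv) (weight_nondecreasing hv)//; case/andP: r01.
have mod_r : modulus (polar r theta) = r.
  by rewrite /modulus/= !exprMn -mulrDr cos2Dsin2 mulr1 sqrtr_sqr ger0_norm.
have := uK (polar r theta); rewrite /unit_disk/= mod_r => {}uK.
have {}uK : `|u (polar r theta)| <= K * v r by apply: uK; case/andP: r01.
have /cvgrPdist_le/(_ _ ltr01) := cu r theta r01; apply: filterS => N.
rewrite /series/= big_mkord distrC => h.
rewrite -[X in `|X|](subrK (u (polar r theta))) (le_trans (ler_normD _ _))//.
apply: le_trans (lerD h uK) _; rewrite -natr1 mulrDl mul1r addrC lerD//.
by rewrite ler_pM2r ?(lt_le_trans _ v1)// ltW// archi_boundP// ltW.
Qed.

(** If [n k.+1 <= 2 n k], monotonicity and doubling would give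
    [g (n k.+1) <= D * g (n k) < A * g (n k)], against the choice of [n k.+1]. *)
Lemma double_lt_next (D A : R) (n : nat -> nat) :
  (forall x : R, 1 <= x -> g (2 * x) <= D * g x) -> D < A -> n 0%N = 1%N ->
  (forall k, is_min [set l : nat | (1 <= l)%N /\ A * g (n k)%:R <= g l%:R] (n k.+1)) ->
  forall k, ((n k).*2 < n k.+1)%N.
Proof.
move=> gD DA n0 nmin.
have n1 k : (1 <= n k)%N by case: k => [|k]; [rewrite n0|have [[]] := nmin k].
move=> k; rewrite ltnNge; apply/negP => nle; have [[_ Ag] _] := nmin k.
have x1 : 1 <= (n k)%:R :> R by rewrite ler1n.
have : g (n k.+1)%:R <= D * g (n k)%:R.
  apply: le_trans (gD _ x1); apply: weight_g_nondecreasing; first by rewrite ler1n.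
  by rewrite -natrM ler_nat mul2n.
have := weight_g_gt0 x1; nra.
Qed.

End Weight.

(** * Square sums of the blocks and almost sure failure of the growth bound *)

Theorem proposition4p2 (R : realType) (v : R -> R) (hv : doubling_weight v) :
  let g := weight_g v in
  exists2 A0 : R, 1 < A0 &
  forall A : R, A0 <= A ->
  forall (d : measure_display) (T : measurableType d) (P : probability T R)
    (xi : nat -> {RV P >-> R}), rademacher_sequence xi ->
  forall n : nat -> nat,
    n 0%N = 1%N ->
    (forall k, is_min [set l : nat | (1 <= l)%N /\ A * g (n k)%:R <= g l%:R]
                      (n k.+1)) ->
  forall nu : nat -> R,
    (forall k, 0 < nu k) ->
    {homo nu : k l / (k <= l)%N >-> k <= l} ->
    nu k @[k --> \oo] --> +oo ->
  forall a : nat -> R,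
    a 0%N = 0 -> a 1%N = 0 -> a 2%N = 0 ->
    (forall j k, (3 <= j)%N -> (1 <= k)%N -> (n k.-1 < j <= n k)%N ->
      a j = nu k * (g (n k)%:R / Num.sqrt ((n k)%:R * ln (n k)%:R))) ->
  (forall k, (1 <= k)%N ->
    Num.sqrt (\sum_((n k.-1).+1 <= j < (n k).+1) a j ^+ 2)
      <= nu k * (g (n k)%:R / Num.sqrt (ln (n k)%:R))) /\
  {ae P, forall w, ~ cos_series_in_hv v (fun j => a j * xi j w)}.
Proof.
move=> g; have [D D0 gD] := weight_g_doubling hv.
(* As [D >= 0], this value exceeds both 1 and the doubling constant. *)
exists (D + 2) => [|A DA d T P xi xiP n n0 nmin nu nu0 _ nuoo a a0 a1 a2 aE]; first by lra.
have n2 : forall k, ((n k).*2 < n k.+1)%N.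
  by apply: (double_lt_next hv gD _ n0 nmin); lra.
have n1 k : (1 <= n k)%N by case: k => [|k]; [rewrite n0|have [[]] := nmin k].
have G0 k : 0 < g (n k)%:R by apply: (weight_g_gt0 hv); rewrite ler1n.
split=> [k k1|].
  have n3 : (3 <= n k)%N.
    rewrite -(prednK k1); apply: leq_trans (n2 _).
    by rewrite ltnS -(doubleS 0) leq_double.
  have N0 : 0 < (n k)%:R :> R by rewrite ltr0n (leq_trans _ n3).
  have L0 : 0 < ln (n k)%:R :> R by rewrite ln_gt0// ltr1n (leq_trans _ n3).
  pose alpha := nu k * (g (n k)%:R / Num.sqrt ((n k)%:R * ln (n k)%:R)).
  have alpha0 : 0 < alpha by rewrite mulr_gt0// divr_gt0// sqrtr_gt0 mulr_gt0.
  have -> : nu k * (g (n k)%:R / Num.sqrt (ln (n k)%:R)) = Num.sqrt ((n k)%:R * alpha ^+ 2).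
    rewrite (sqrtrM _ (ltW N0)) sqrtr_sqr gtr0_norm// /alpha (sqrtrM _ (ltW N0)).
    by field; rewrite !gt_eqF ?sqrtr_gt0.
  apply: ler_wsqrtr.
  apply: (@le_trans _ _ (\sum_((n k.-1).+1 <= j < (n k).+1) alpha ^+ 2)).
    rewrite !big_nat; apply: ler_sum => j jn.
    (* The first block may contain an index below 3; there the coefficient is 0 and the bound by
       [alpha] persists. *)
    have [j3|] := leqP 3 j; first by rewrite (aE _ _ j3 k1).
    by case: j {jn} => [|[|[|//]]] _; rewrite ?a0 ?a1 ?a2 expr0n sqr_ge0.
  rewrite sumr_const_nat subSS -[leLHS]mulr_natl ler_pM2r ?exprn_gt0//.
  by rewrite ler_nat leq_subr.
apply: (@negligibleS _ _ _ _ (\bigcup_K [set w | forall r theta : R, 0 <= r < 1 ->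
   \forall N \near \oo,
    `|\sum_(j < N) a j * xi j w * r ^+ j * cos (j%:R * theta)| <= K.+1%:R * v r])).
  move=> w /= /contrapT/(cos_series_in_hv_bounded hv)[K HK].
  by exists K.
apply: negligible_bigcup => K; apply: (negligible_rademacher xiP) => eps eps0.
have [k [m [nk2 small]]] := exists_small_block n2 G0 nuoo nu0 aE (ltr0Sn R K) eps0.
exists (n k).+1, (fun N => [pred f : {ffun 'I_N -> bool} | [forall i : 'I_(2 ^ m),
  `|\sum_(j < N) a j * (1 - (n k)%:R^-1) ^+ j * cos (j%:R * grid R i) * (-1) ^+ f j|
    <= K.+1%:R * g (n k)%:R]]); split=> [N|w Aw /choice[b xib]]; first exact: small.
have nk1 : 1 <= (n k)%:R :> R by rewrite ler1n.
have r01 := one_subV_itv nk1.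
(* The grid is finite, so one threshold on [N] serves all its points. *)
have : \forall N \near \oo, forall i : 'I_(2 ^ m),
    `|\sum_(j < N) a j * xi j w * (1 - (n k)%:R^-1) ^+ j * cos (j%:R * grid R i)|
      <= K.+1%:R * v (1 - (n k)%:R^-1).
  by apply: filter_forall => i; apply: Aw.
apply: filterS => N HN; exists [ffun j : 'I_N => b j] => [|j]; last by rewrite ffunE.
rewrite inE; apply/forallP => i; apply: le_trans (HN i).
rewrite le_eqVlt; apply/orP; left; apply/eqP; congr `|_|.
by apply: eq_bigr => j _; rewrite ffunE xib; ring.
Qed.
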